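(* Let $\alpha>1$ and $\varepsilon\ge0$. A mechanism $M$ on $\mathsf{X}$ is $(\alpha,\varepsilon)$-RDP if and only if $M$ is $(L,\mathcal{H},g_\alpha,e^{(\alpha-1)\varepsilon})$-PPE, where $g_\alpha(s)=e^{(\alpha-1)s}$.
   Context: $(\mathsf{X},\mathcal{X})$ is a measurable space of datasets with $\{x\}\in\mathcal{X}$ for all $x$. A mechanism $M$ is a Markov kernel from $\mathsf{X}$ to a measurable output space; $\mathbb{E}_x$ denotes expectation under $T\sim M(x,\cdot)$. A symmetric binary neighbour relation $\sim$ on $\mathsf{X}$ is fixed. Rényi DP: for $\alpha>1$, $M$ is $(\alpha,\varepsilon)$-RDP if $\sup_{x\sim x'}D_\alpha[M(x',\cdot)\Vert M(x,\cdot)]\le\varepsilon$, where $D_\alpha[P\Vert P']=\frac1{\alpha-1}\log\mathbb{E}_{X\sim P}\left[\frac{\mathrm{d}P}{\mathrm{d}P'}(X)^{\alpha-1}\right]$ ($+\infty$ if $P$ is not absolutely continuous with respect to $P'$). Priors: $\mathcal{P}_2$ is the set of probability measures $Q=\sum_{z\in\mathsf{Z}}w_z\delta_z$ with $\mathsf{Z}\subset\mathsf{X}$, $|\mathsf{Z}|=2$, $w_z>0$, $\sum_zw_z=1$, and $\mathcal{H}=\{Q\in\mathcal{P}_2:\exists z\sim z',\ Q(\{z,z'\})=1\}$. Score: $L(Q,x)=-\log Q(\{x\})$ with $\log0=-\infty$. Posterior: $Q_T$ is the Bayes posterior of $Q$ after observing $T$. For $Q\in\mathcal{H}$ with support $\{x,x'\}$,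 $w=Q(\{x\})\in(0,1)$, and $m(x,\cdot),m(x',\cdot)$ densities of $M(x,\cdot),M(x',\cdot)$ with respect to a common dominating measure, $Q_T(\{x\})=\frac{m(x,T)w}{m(x,T)w+m(x',T)(1-w)}$; if $Q(\{x\})=0$ then $Q_T(\{x\})=0$. Persuasive privacy in expectation: for a score $S$, class of priors $\mathcal{Q}$, function $g$ and $\kappa\ge0$, $M$ is $(S,\mathcal{Q},g,\kappa)$-PPE if $$\sup_{x\in\mathsf{X}}\sup_{Q\in\mathcal{Q}}\mathbb{E}_x\left[g\{\Delta_S(Q,T,x)\}\right]\le\kappa,\qquad\Delta_S(Q,T,x)=S(Q,x)-S(Q_T,x),$$ with the convention $\infty-\infty=0$. *)

(* Defs.v *)
From HB Require Import structures.
From mathcomp Require Import all_boot all_order all_algebra finmap.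
From mathcomp Require Import all_classical all_reals all_analysis measurable_realfun.

Set Implicit Arguments.
Unset Strict Implicit.
Unset Printing Implicit Defensive.

Import Order.TTheory GRing.Theory Num.Theory.
Import numFieldNormedType.Exports.

Local Open Scope classical_set_scope.
Local Open Scope ring_scope.
Local Open Scope ereal_scope.
Local Open Scope charge_scope.

(* The values of a probability kernel are typed as mere measures; this
   repackages the measure [k x] as a [probability]. *)
Section law.
Context d d' (X : measurableType d) (Y : measurableType d') (R : realType).
Variables (k : R.-pker X ~> Y) (x : X).

Definition law_fun : set Y -> \bar R := k x.

HB.instance Definition _ := isMeasure.Build _ Y R law_fun
  (measure0 (k x)) (measure_ge0 (k x)) (@measure_semi_sigma_additive _ _ _ (k x)).
HB.instance Definition _ :=
  Measure_isProbability.Build _ Y R law_fun (prob_kernel x).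

Definition law : probability Y R := law_fun.

End law.

Section renyi.
Context d (Y : measurableType d) (R : realType).

Definition renyi_divergence (a : R) (P P' : probability Y R) : \bar R :=
  if `[< P `<< P' >] then
    ((a - 1)^-1)%:E *
    lne (\int[P]_y (('d (charge_of_finite_measure P) '/d P') y `^ (a - 1)))
  else +oo.

End renyi.

Section privacy.
Context d d' (X : measurableType d) (Y : measurableType d') (R : realType).
Variable nb : X -> X -> Prop.

Definition RDP (M : R.-pker X ~> Y) (a e : R) : Prop :=
  ereal_sup [set renyi_divergence a (law M p.2) (law M p.1)
            | p in [set p : X * X | nb p.1 p.2]] <= e%:E.

Definition two_point_prior : set (probability X R) :=
  [set Q | exists (Z : {fset X}) (w : X -> R),
    [/\ #|` Z| = 2%N, (forall z, z \in Z -> (0 < w z)%R),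
        (\sum_(z <- Z) w z = 1)%R
      & forall A, measurable A -> Q A = \sum_(z <- Z) (w z)%:E * \d_z A]].

Definition neighbour_prior : set (probability X R) :=
  [set Q | two_point_prior Q /\
    exists z z', nb z z' /\ Q [set z; z'] = 1].

Definition log_score (Q : probability X R) (x : X) : \bar R :=
  - lne (Q [set x]).

(* Subtraction with [oo - oo = 0]; the library's subtraction gives [-oo]. *)
Definition score_sub (a b : \bar R) : \bar R :=
  match a, b with
  | +oo, +oo | -oo, -oo => 0
  | _, _ => a - b
  end.

Definition score_gain (S : probability X R -> X -> \bar R)
    (Q QT : probability X R) (x : X) : \bar R :=
  score_sub (S Q x) (S QT x).

Definition is_density (mu P : {measure set Y -> \bar R}) (m : Y -> R) : Prop :=
  [/\ measurable_fun setT m, (forall t, (0 <= m t)%R)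
    & forall A, measurable A -> P A = \int[mu]_(t in A) (m t)%:E].

(* [K] is a version of the map [t |-> Q_t] for a two-point prior [Q]: Bayes'
   formula holds for some choice of the dominating measure and of the
   densities. Nothing is required on the support of [Q] where the denominator
   vanishes, which is a null event under both [M x] and [M x']. *)
Definition is_posterior (M : R.-pker X ~> Y) (Q : probability X R)
    (K : R.-pker Y ~> X) : Prop :=
  (forall x, Q [set x] = 0 -> forall t, K t [set x] = 0) /\
  exists (mu : {measure set Y -> \bar R}) (m : X -> Y -> R),
    (forall x, Q [set x] != 0 -> is_density mu (M x) (m x)) /\
    forall x x', x != x' -> Q [set x] != 0 -> Q [set x'] != 0 ->
      let w := fine (Q [set x]) in
      forall t, let D := (m x t * w + m x' t * (1 - w))%R in
        D != 0%R -> K t [set x] = (m x t * w / D)%:E.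

Definition PPE (M : R.-pker X ~> Y)
    (post : probability X R -> R.-pker Y ~> X)
    (S : probability X R -> X -> \bar R) (Qs : set (probability X R))
    (g : \bar R -> \bar R) (kappa : R) : Prop :=
  ereal_sup [set ereal_sup
      [set \int[law M x]_t g (score_gain S Q (law (post Q) t) x) | Q in Qs]
    | x in [set: X]] <= kappa%:E.

Definition exp_gain (a : R) (s : \bar R) : \bar R := expeR ((a - 1)%:E * s).

End privacy.
Arguments two_point_prior {d X R}.
Arguments neighbour_prior {d X R}.
Arguments log_score {d X R}.

(* Posteriors exist, so that quantifying over their versions is not vacuous. *)
Section posterior_exists.
Context d d' (X : measurableType d) (Y : measurableType d') (R : realType).

Section mixture.
Variables (x x' : X) (W : Y -> R).
Hypotheses (W0 : forall t, (0 <= W t)%R) (W1 : forall t, (0 <= 1 - W t)%R).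
Hypothesis mW : measurable_fun setT W.

Definition mixture (t : Y) : {measure set X -> \bar R} :=
  measure_add (mscale (NngNum (W0 t)) \d_x) (mscale (NngNum (W1 t)) \d_x').

Lemma mixtureE t A :
  mixture t A = (W t)%:E * \d_x A + (1 - W t)%:E * \d_x' A.
Proof. exact: measure_addE. Qed.

Let mixture_measurable U : measurable U ->
  measurable_fun [set: Y] (mixture ^~ U).
Proof.
move=> mU.
under eq_fun do rewrite mixtureE.
apply: emeasurable_funD; apply: emeasurable_funM => //; apply/measurable_EFinP => //.
exact: measurable_funB.
Qed.

HB.instance Definition _ := isKernel.Build _ _ _ _ R mixture mixture_measurable.

Let mixture_prob t : mixture t [set: X] = 1.
Proof. by rewrite mixtureE !diracT !mule1 -EFinD addrCA subrr addr0. Qed.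

HB.instance Definition _ :=
  Kernel_isProbability.Build _ _ _ _ R mixture mixture_prob.

Definition mixture_kernel : R.-pker Y ~> X := mixture.

End mixture.

Section law_sum.
Variables (M : R.-pker X ~> Y) (x x' : X).

Definition law_sum : set Y -> \bar R := measure_add (M x) (M x').

Let law_sum_fin : fin_num_fun law_sum.
Proof.
move=> A mA; rewrite [law_sum A]measure_addE fin_numD.
by rewrite (fin_num_measure (law M x))// (fin_num_measure (law M x')).
Qed.

HB.instance Definition _ := Measure.copy law_sum (measure_add (M x) (M x')).
HB.instance Definition _ := Measure_isFinite.Build _ Y R law_sum law_sum_fin.

End law_sum.

Lemma posterior_exists (M : R.-pker X ~> Y)
    (mX : forall x : X, measurable [set x]) (Q : probability X R) :
  two_point_prior Q -> exists K, is_posterior M Q K.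
Proof.
move=> [Z [v [Z2 v0 v1 QE]]].
have [x [x' [xx' ZE]]] : exists x x', x != x' /\ enum_fset Z = [:: x; x'].
  move: Z2 (fset_uniq Z); rewrite /=.
  case: (enum_fset Z) => [|x [|x' []]]//= _.
  by rewrite inE andbT => xx'; exists x, x'.
move: v1 QE; rewrite ZE big_cons big_seq1 => v1 QE.
have {}QE A : measurable A -> Q A = (v x)%:E * \d_x A + (v x')%:E * \d_x' A.
  by move=> mA; rewrite QE// big_cons big_seq1.
have memZ z : z \in [:: x; x'] -> z \in Z by rewrite -ZE.
have vx : (0 < v x)%R by apply/v0/memZ; rewrite inE eqxx.
have vx' : (0 < v x')%R.
  by apply/v0/memZ; rewrite !inE eqxx orbT.
have dE (y z : X) : \d_y [set z] = (y == z)%:R%:E :> \bar R.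
  rewrite diracE; have [->|/eqP yz] := eqVneq y z; first by rewrite mem_set.
  by rewrite memNset.
have x'x : x' != x by rewrite eq_sym.
have QxE z : Q [set z] = (v x * (x == z)%:R + v x' * (x' == z)%:R)%:E.
  by rewrite QE// !dE.
have Qx : Q [set x] = (v x)%:E.
  by rewrite QxE eqxx (negbTE x'x) mulr1 mulr0 addr0.
have Qx' : Q [set x'] = (v x')%:E.
  by rewrite QxE eqxx (negbTE xx') mulr1 mulr0 add0r.
have Qsup z : Q [set z] != 0 -> z = x \/ z = x'.
  rewrite QxE; have [->|_] := eqVneq x z; first by left.
  have [->|_] := eqVneq x' z; first by right.
  by rewrite !mulr0 addr0 eqxx.
pose nu : {finite_measure set Y -> \bar R} := law_sum M x x'.
have nuE A : nu A = M x A + M x' A by exact: measure_addE.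
pose m z t := fine (Radon_Nikodym_SigmaFinite.f (law M z) nu t).
have dom z : Q [set z] != 0 -> law M z `<< nu.
  move=> /Qsup zx; apply/null_content_dominatesP => A mA /eqP.
  rewrite [X in X == 0 -> _]nuE padde_eq0//.
  by case/andP => /eqP h1 /eqP h2; case: zx => ->.
have mdens z : Q [set z] != 0 -> is_density nu (M z) (m z).
  move=> /dom ac; split.
  - apply: measurableT_comp => //.
    by have /measurable_int := Radon_Nikodym_SigmaFinite.f_integrable ac.
  - by move=> t; apply: fine_ge0; exact: Radon_Nikodym_SigmaFinite.f_ge0.
  - move=> A mA; rewrite [LHS](Radon_Nikodym_SigmaFinite.f_integral ac mA).
    apply: eq_integral => t _.
    by rewrite fineK//; exact: Radon_Nikodym_SigmaFinite.f_fin_num.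
have Qx0 : Q [set x] != 0 by rewrite Qx eqe gt_eqF.
have Qx'0 : Q [set x'] != 0 by rewrite Qx' eqe gt_eqF.
have [mmx mx0 _] := mdens _ Qx0; have [mmx' mx'0 _] := mdens _ Qx'0.
pose D t := (m x t * v x + m x' t * v x')%R.
have D0 t : (0 <= D t)%R by rewrite addr_ge0// mulr_ge0// ltW.
pose W t := (m x t * v x / D t)%R.
have W0 t : (0 <= W t)%R by rewrite divr_ge0// mulr_ge0// ltW.
have W1 t : (0 <= 1 - W t)%R.
  rewrite subr_ge0 /W; have [->|Dt] := eqVneq (D t) 0%R.
    by rewrite invr0 mulr0.
  rewrite ler_pdivrMr ?lt_neqAle 1?eq_sym ?Dt ?D0// mul1r lerDl.
  by rewrite mulr_ge0// ltW.
have mD : measurable_fun setT D.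
  by apply: measurable_funD; apply: measurable_funM.
have mW : measurable_fun setT W.
  apply: measurable_funM; first exact: measurable_funM.
  rewrite [X in measurable_fun _ X](_ : _ = fun t => powR (D t) (-1)).
    exact: measurableT_comp (measurable_powR _) mD.
  by apply/funext => t; rewrite powR_inv1.
exists (mixture_kernel x x' W0 W1 mW); split.
  move=> z /eqP; rewrite QxE eqe => Qz t; rewrite mixtureE !dE.
  have [xz|_] := eqVneq x z.
    by move: Qz; rewrite -xz eqxx (negbTE x'x) mulr0 addr0 mulr1 gt_eqF.
  have [x'z|_] := eqVneq x' z.
    by move: Qz; rewrite -x'z eqxx (negbTE xx') mulr0 add0r mulr1 gt_eqF.
  by rewrite !mule0 adde0.
exists nu, m; split=> // y y' yy' /Qsup yE /Qsup y'E /=.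
have v'E : (1 - v x = v x')%R by rewrite -v1 addrC addKr.
have vE : (1 - v x' = v x)%R by rewrite -v1 addrK.
case: yE y'E yy' => -> [] ->; rewrite ?eqxx// => _ t.
  rewrite Qx /= v'E => Dt.
  by rewrite mixtureE !dE eqxx (negbTE x'x) mule0 adde0 mule1.
rewrite Qx' /= vE => Dt; rewrite mixtureE !dE eqxx (negbTE xx') mule0 add0e mule1.
have Dt' : D t != 0%R by rewrite /D addrC.
congr (_%:E); rewrite /W [X in (_ = _ / X)%R]addrC -/(D t).
by apply: (mulIf Dt'); rewrite mulrBl mul1r !divfK// /D addrC addKr.
Qed.

End posterior_exists.

(* Main.v *)
Require Import Defs.
From mathcomp Require Import lra.
From mathcomp Require Import all_boot all_order all_algebra finmap.
From mathcomp Require Import all_classical all_reals all_analysis measurable_realfun.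

(** Let [x] and [x'] be distinct neighbours and let [m], [m'] be densities of
   [P = M x] and [P' = M x'] for a common measure. For the prior with mass [w]
   at [x] and [1 - w] at [x'], Bayes' formula turns the exponentiated gain
   [exp ((alpha - 1) * Delta)] at [x] into the power [alpha - 1] of
   [bayes_factor w m m' = m / (m * w + m' * (1 - w))], the ratio of posterior
   to prior mass. At [w = 0] this factor is the likelihood ratio [m / m'],
   whose moment of order [alpha - 1] under [P] is the integral inside the
   logarithm of the Renyi divergence of [P] from [P']. So, with [J w] the
   moment [bayes_moment], the theorem compares a bound
   [k = exp ((alpha - 1) * eps)] on [J 0] with the same bound on [J w] for all
   [w] in ]0, 1[.

   From [J 0] to [J w] ([bayes_moment_le]): the function [w |-> J w] lies below
   its chord between [w = 0] and [w = 1], by the pointwise convexity inequality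
   [bayes_factor_powR_le], so [J w <= w + (1 - w) * k], which is at most [k]
   because [1 <= k]; this is where [0 <= eps] enters. From [J w] to [J 0]
   ([bayes_moment_null], [bayes_moment0_le]): let [w] tend to 0. On the event
   [m' = 0] the factor is [1 / w], so this event must be null under [P], which
   is absolute continuity; elsewhere the factors converge to [m / m'] and
   Fatou's lemma applies.

   Two points need care. The prior varies with [w], and each posterior may come
   with its own dominating measure and densities; [density_proportional] shows
   that the ratio [m : m'] is almost surely the same for all choices.
   The dominating measures are arbitrary, not even sigma-finite, so the change
   of variables [integral_density] is proved from simple functions, and
   uniqueness of densities is always invoked for finite measures [P]. The
   quotient [m / m'] is then a density of [P] with respect to [P']
   ([density_div]), hence agrees with the Radon-Nikodym derivative in the Renyi
   divergence.

   Neighbours [x = x'] carry no two-point prior, but then the divergence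
   vanishes ([renyi_divergence_refl]); a dataset outside the support of the
   prior has gain 0, whose exponential is 1. *)

Set Implicit Arguments.
Unset Strict Implicit.
Unset Printing Implicit Defensive.

Import Order.TTheory GRing.Theory Num.Theory.
Import numFieldNormedType.Exports.

Local Open Scope classical_set_scope.
Local Open Scope ring_scope.

(** * Densities with respect to an arbitrary dominating measure *)

Section measurable_quotient.
Context d (Y : measurableType d) (R : realType).

(** Nonnegativity of the denominator lets the inverse be written as the
   measurable power [powR _ (-1)], which agrees with it at 0 as well. *)
Lemma measurable_fun_div (f g : Y -> R) : (forall t, 0 <= g t) ->
  measurable_fun setT f -> measurable_fun setT g ->
  measurable_fun setT (fun t => f t / g t).
Proof.
move=> g0 mf mg; apply: measurable_funM => //.
rewrite [X in measurable_fun _ X](_ : _ = fun t => powR (g t) (-1)).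
  exact: measurableT_comp (measurable_powR _) mg.
by apply/funext => t; rewrite powR_inv1.
Qed.

Lemma measurable_zeros (f : Y -> R) :
  measurable_fun setT f -> measurable [set t | f t = 0].
Proof.
move=> mf; rewrite -[X in measurable X]setTI.
exact: (mf measurableT [set 0]).
Qed.

End measurable_quotient.

Section density.
Context d (Y : measurableType d) (R : realType).
Implicit Types (mu P : {measure set Y -> \bar R}) (m : Y -> R).
Local Open Scope ereal_scope.
Import HBNNSimple.

(** Both sides are limits of the integrals of simple functions increasing to
   [f], and on an indicator the identity is the definition of a density.
   As [mu] may fail to be sigma-finite, [m] is not treated as a Radon-Nikodym
   derivative. *)
Lemma integral_density mu P m (f : Y -> \bar R) E : is_density mu P m ->
  measurable E -> measurable_fun E f -> (forall t, 0 <= f t) ->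
  \int[P]_(t in E) f t = \int[mu]_(t in E) (f t * (m t)%:E).
Proof.
move=> [mm m0 Pm] mE mf f0.
have mme : measurable_fun E (EFin \o m).
  exact/measurable_funTS/measurable_EFinP.
pose h := nnsfun_approx mE mf.
have hf t : E t -> (h n t)%:E @[n --> \oo] --> f t.
  by move=> Et; exact: cvg_nnsfun_approx.
have mh n D : measurable_fun D (fun t => (h n t)%:E).
  exact/measurable_funTS/measurable_EFinP.
have h_nd t a b : (a <= b)%N -> ((h a t)%:E <= (h b t)%:E)%O.
  by move=> ab; rewrite lee_fin; exact/lefP/nd_nnsfun_approx.
transitivity (limn (fun n => \int[P]_(t in E) (h n t)%:E)).
  rewrite -monotone_convergence//; last 2 first.
    by move=> *; rewrite lee_fin.
    by move=> t _ a b; exact: h_nd.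
  by apply: eq_integral => t /[!inE] Et; apply/esym/cvg_lim => //; exact: hf.
transitivity (limn (fun n => \int[mu]_(t in E) ((h n t)%:E * (m t)%:E)));
  last first.
  rewrite -monotone_convergence//.
  - apply: eq_integral => t /[!inE] Et; apply/cvg_lim => //.
    by apply: cvgeZr => //; exact: hf.
  - by move=> n; apply: emeasurable_funM.
  - by move=> n t _; rewrite mule_ge0 ?lee_fin.
  - by move=> t _ a b ab; rewrite lee_wpmul2r ?lee_fin//; exact: h_nd.
congr (limn _); apply/funext => n.
have mI (r : R) B : measurable B -> measurable_fun E (fun t => (r * \1_B t)%:E).
  by move=> mB; apply/measurable_EFinP; apply: measurable_funM.
have hE t : (h n t)%:E =
    \sum_(r \in range (h n)) (r * \1_(h n @^-1` [set r]) t)%:E.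
  by rewrite fimfunE -fsumEFin.
under eq_integral => t _ do rewrite hE.
rewrite ge0_integral_fsum//; [|by move=> r; exact: mI|
  by move=> r t _; exact: nnfun_muleindic_ge0].
under [RHS]eq_integral => t _.
  rewrite hE ge0_mule_fsuml; last by move=> r; exact: nnfun_muleindic_ge0.
  over.
rewrite ge0_integral_fsum//; last 2 first.
  by move=> r; apply: emeasurable_funM => //; exact: mI.
  by move=> r t _; rewrite mule_ge0 ?lee_fin//; exact: nnfun_muleindic_ge0.
apply: eq_fsbigr => r /[!inE] -[s _ rE].
have r0 : (0 <= r)%R by rewrite -rE.
have mB : measurable (h n @^-1` [set r]) by [].
set B := h n @^-1` [set r] in mB *.
under eq_integral do rewrite EFinM.
under [RHS]eq_integral do rewrite EFinM -muleA.
rewrite !ge0_integralZl//; last 3 first.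
- by apply: emeasurable_funM => //; exact/measurable_EFinP.
- by move=> t _; rewrite mule_ge0 ?lee_fin.
- exact/measurable_EFinP.
congr (_ * _); rewrite integral_indic// setIC Pm; last exact: measurableI.
under [RHS]eq_integral do rewrite muleC.
rewrite [RHS](eq_integral ((EFin \o m) \_ B)); last first.
  by move=> t _; rewrite epatch_indic.
by rewrite -integral_mkcondr.
Qed.

Lemma density_zero mu P m : is_density mu P m -> P [set t | m t = 0%R] = 0.
Proof.
move=> [mm m0 Pm].
rewrite Pm//; last exact: measurable_zeros.
rewrite integral0_eq// => t ->//.
Qed.

Lemma ae_gt0 P m : measurable_fun setT m -> (forall t, 0 <= m t)%R ->
  P [set t | m t = 0%R] = 0 -> {ae P, forall t, (0 < m t)%R}.
Proof.
move=> mm m0 N0; exists [set t | m t = 0%R]; split => //.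
  exact: measurable_zeros.
by move=> t /= /negP; rewrite -leNgt => mt; apply/eqP; rewrite eq_le mt m0.
Qed.

Lemma density_ae_gt0 mu P m : is_density mu P m ->
  {ae P, forall t, (0 < m t)%R}.
Proof.
by move=> mP; have [mm m0 _] := mP; apply: ae_gt0 => //; exact: density_zero mP.
Qed.

Lemma density_unique mu (P : {finite_measure set Y -> \bar R}) p q :
  is_density mu P p -> is_density mu P q -> {ae mu, forall t, p t = q t}.
Proof.
move=> [mp p0 Pp] [mq q0 Pq].
have : ae_eq mu setT (EFin \o p) (EFin \o q).
  apply: integral_ae_eq => //.
  - apply/integrableP; split; first exact/measurable_EFinP.
    under eq_integral do rewrite gee0_abs ?lee_fin//.
    by rewrite -Pp// -ge0_fin_numE// fin_num_measure.
  - exact/measurable_EFinP.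
  - by move=> E _ mE; rewrite -Pp// -Pq.
by apply: filterS => t /(_ I) [].
Qed.

(** Passing to the finite measure [P + P'] replaces a dominating measure that
   depends on the choice of densities by one that does not: [m + m'] is the
   density of [P + P'], and dividing by it gives [P] its density there. *)
Lemma density_ratio mu P P' m m' : is_density mu P m -> is_density mu P' m' ->
  is_density (measure_add P P') P (fun t => m t / (m t + m' t))%R.
Proof.
move=> mP mP'; have [mm m0 PE] := mP; have [mm' m'0 _] := mP'.
have mr : measurable_fun setT (fun t => m t / (m t + m' t))%R.
  apply: measurable_fun_div => //; first by move=> t; rewrite addr_ge0.
  exact: measurable_funD.
have r0 t : (0 <= m t / (m t + m' t))%R by rewrite divr_ge0// addr_ge0.
have mre (f : Y -> R) A : measurable_fun setT f ->
    measurable_fun A (EFin \o f).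
  by move=> mf; apply/measurable_funTS/measurable_EFinP.
split => // A mA; rewrite ge0_integral_measure_add//; last 2 first.
  by move=> t _; rewrite lee_fin.
  exact: mre.
rewrite (integral_density mP)//; last exact: mre.
rewrite (integral_density mP')//; last exact: mre.
rewrite -ge0_integralD//; last 4 first.
- by move=> t _; rewrite lee_fin mulr_ge0.
- by apply: emeasurable_funM; exact: mre.
- by move=> t _; rewrite lee_fin mulr_ge0.
- by apply: emeasurable_funM; exact: mre.
rewrite PE//; apply: eq_integral => t _.
rewrite -!EFinM -EFinD -mulrDr; congr EFin.
(* where both densities vanish the quotient is 0, which is still [m t] *)
have [s0|s0] := eqVneq (m t + m' t)%R 0%R; last by rewrite divfK.
have : (m t + m' t == 0)%R by rewrite s0.
by rewrite paddr_eq0// => /andP[/eqP -> _]; rewrite !mul0r.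
Qed.

(** The densities of [P] with respect to [P + P'] obtained from the two pairs
   coincide almost everywhere, and [m / (m + m') = n / (n + n')] is a
   proportion between the pairs once the denominators are positive. *)
Lemma density_proportional (P P' : {finite_measure set Y -> \bar R})
    mu m m' nu n n' :
  is_density mu P m -> is_density mu P' m' ->
  is_density nu P n -> is_density nu P' n' ->
  {ae P, forall t, m t * n' t = n t * m' t}%R.
Proof.
move=> mP mP' nP nP'.
have [_ m0 _] := mP; have [_ m'0 _] := mP'.
have [_ n0 _] := nP; have [_ n'0 _] := nP'.
have PPP' : P `<< measure_add P P'.
  apply/null_content_dominatesP => A mA /eqP.
  by rewrite [X in X == 0 -> _]measure_addE padde_eq0// => /andP[/eqP].
have := density_unique (density_ratio mP mP') (density_ratio nP nP').
case=> N [mN N0 sN].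
have : {ae P, forall t, m t / (m t + m' t) = n t / (n t + n' t)}%R.
  by exists N; split => //; move/null_content_dominatesP : PPP'; exact.
have mg := density_ae_gt0 mP; have ng := density_ae_gt0 nP.
apply: filterS3 mg ng => t mt nt /eqP.
have mD : (m t + m' t != 0)%R by rewrite gt_eqF// ltr_pwDl.
have nD : (n t + n' t != 0)%R by rewrite gt_eqF// ltr_pwDl.
by rewrite eqr_div// !mulrDr [(m t * n t)%R]mulrC => /eqP /addrI.
Qed.

End density.

(** * The ratio of posterior to prior mass *)

Section bayes_factor.
Context (R : realType).
Implicit Types (c p q w : R).

(** With likelihoods [p] and [q] of two hypotheses of prior masses [w] and
   [1 - w], the posterior mass of the first one divided by [w]. The division
   is carried out so that [w = 0] is meaningful. *)
Definition bayes_factor w p q : R := p / (p * w + q * (1 - w)).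

Lemma bayes_factor0 p q : bayes_factor 0 p q = p / q.
Proof. by rewrite /bayes_factor mulr0 add0r subr0 mulr1. Qed.

(** The weighted arithmetic-geometric inequality bounds the denominator below
   by [p `^ w * q `^ (1 - w)], so the left-hand side is at most
   [(p / q) `^ (c * (1 - w))]; convexity of [expR] between exponents 0 and
   [c * ln (p / q)] concludes. *)
Lemma bayes_factor_powR_le c w p q : 0 <= c -> 0 <= w <= 1 -> 0 < p -> 0 < q ->
  bayes_factor w p q `^ c <= w + (1 - w) * (p / q) `^ c.
Proof.
move=> c0 /andP[w0 w1] p0 q0.
pose l := Itv01 w0 w1.
have D0 : 0 < p * w + q * (1 - w).
  have [->|wn0] := eqVneq w 0; first by rewrite mulr0 add0r subr0 mulr1.
  by rewrite ltr_pwDl// ?mulr_gt0// ?lt0r ?wn0// mulr_ge0 ?subr_ge0// ltW.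
have powE x : 0 < x -> x `^ c = expR (c * ln x).
  by move=> x0; rewrite /powR gt_eqF.
rewrite !powE ?divr_gt0// !ln_div ?posrE//.
have := concave_ln l p0 q0.
rewrite !convRE /unstable.onem/= ![_ * p]mulrC ![_ * q]mulrC => lnD.
have := convex_expR l 0 (c * (ln p - ln q)).
rewrite !convRE /unstable.onem/= expR0 mulr1 mulr0 add0r; apply: le_trans.
rewrite ler_expR mulrCA ler_wpM2l//.
by lra.
Qed.

(** The weights [1 / (n + 2)] start at [n + 2] to stay inside ]0, 1[. *)
Lemma cvg_bayes_factor c p q : 0 < p -> 0 < q ->
  bayes_factor n.+2%:R^-1 p q `^ c @[n --> \oo] --> bayes_factor 0 p q `^ c.
Proof.
move=> p0 q0.
have cvg0 : (n.+2%:R^-1 : R) @[n --> \oo] --> (0 : R).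
  have := @cvg_harmonic R; rewrite -(cvg_shiftS (@harmonic R)).
  by [].
have cl : bayes_factor n.+2%:R^-1 p q @[n --> \oo] --> bayes_factor 0 p q.
  apply: cvgM; first exact: cvg_cst.
  apply: cvgV; first by rewrite mulr0 add0r subr0 mulr1 gt_eqF.
  apply: cvgD; first by apply: cvgM => //; exact: cvg_cst.
  by apply: cvgM; [exact: cvg_cst|apply: cvgB => //; exact: cvg_cst].
have /derivable1_diffP/differentiable_continuous :
    derivable (fun x : R => x `^ c) (bayes_factor 0 p q) 1.
  by apply: derivable_powR; rewrite in_itv/= andbT bayes_factor0 divr_gt0.
exact: cvg_comp cl.
Qed.

End bayes_factor.

Section bayes_moment.
Context d (Y : measurableType d) (R : realType) (P : probability Y R).
Variables (p q : Y -> R) (c : R).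
Hypothesis c_gt0 : 0 < c.
Hypotheses (mp : measurable_fun setT p) (mq : measurable_fun setT q).
Hypotheses (p_ge0 : forall t, 0 <= p t) (q_ge0 : forall t, 0 <= q t).
Hypothesis p_gt0 : {ae P, forall t, 0 < p t}.
Local Open Scope ereal_scope.

Definition bayes_moment w : \bar R :=
  \int[P]_t (bayes_factor w (p t) (q t) `^ c)%:E.

Lemma measurable_bayes_factor_powR w (A : set Y) : (0 <= w <= 1)%R ->
  measurable_fun A (fun t => (bayes_factor w (p t) (q t) `^ c)%:E).
Proof.
move=> /andP[w0 w1]; apply/measurable_funTS/measurable_EFinP.
apply: (measurableT_comp (measurable_powR c)).
apply: measurable_fun_div => //.
  by move=> t; rewrite addr_ge0// mulr_ge0// subr_ge0.
by apply: measurable_funD; apply: measurable_funM.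
Qed.

Let factor_ge0 w t : 0 <= (bayes_factor w (p t) (q t) `^ c)%:E.
Proof. by rewrite lee_fin powR_ge0. Qed.

(** Integrating [bayes_factor_powR_le] gives
   [bayes_moment w <= w + (1 - w) * bayes_moment 0], a convex combination of
   1 and a number at most [k]. *)
Lemma bayes_moment_le (k w : R) : {ae P, forall t, 0 < q t}%R ->
  (0 <= w <= 1)%R -> (1 <= k)%R ->
  bayes_moment 0 <= k%:E -> bayes_moment w <= k%:E.
Proof.
move=> q_gt0 w01 k1 l0; have /andP[w0 w1] := w01.
have w'0 : (0 <= 1 - w)%R by rewrite subr_ge0.
have m0 A : measurable_fun A (fun t => (bayes_factor 0 (p t) (q t) `^ c)%:E).
  by apply: measurable_bayes_factor_powR; rewrite lexx ler01.
have mS : measurable_fun setT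
    (fun t => (1 - w)%:E * (bayes_factor 0 (p t) (q t) `^ c)%:E).
  by apply: emeasurable_funM.
apply: (@le_trans _ _ (\int[P]_t
    (w%:E + (1 - w)%:E * (bayes_factor 0 (p t) (q t) `^ c)%:E))).
  apply: ae_ge0_le_integral => //.
  - exact: measurable_bayes_factor_powR.
  - by move=> t _; rewrite adde_ge0 ?lee_fin// mulr_ge0// powR_ge0.
  - exact: emeasurable_funD.
  - apply: filterS2 p_gt0 q_gt0 => t pt qt _.
    rewrite -EFinM -EFinD lee_fin bayes_factor0.
    by apply: bayes_factor_powR_le => //; exact: ltW.
rewrite ge0_integralD//; last first.
  by move=> t _; rewrite mule_ge0 ?lee_fin ?powR_ge0.
rewrite ge0_integralZl//.
rewrite integral_cst//.
rewrite [X in w%:E * X]probability_setT mule1.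
apply: (@le_trans _ _ (w%:E + (1 - w)%:E * k%:E)).
  by rewrite leeD2l// lee_wpmul2l// lee_fin.
by rewrite -EFinM -EFinD lee_fin; nra.
Qed.

Variable k : R.
Hypothesis bayes_moment_bound :
  forall w, (0 < w < 1)%R -> bayes_moment w <= k%:E.

(** On [q = 0] the factor is [1 / w] wherever [p > 0], so
   [w `^ (- c) * P [q = 0] <= k] for all [w], which forces the mass to vanish
   as [w] tends to 0. *)
Lemma bayes_moment_null : P [set t | q t = 0%R] = 0.
Proof.
set N := [set t | _].
have mN : measurable N by exact: measurable_zeros.
have PN v : (1 < v)%R -> (v `^ c)%:E * P N <= k%:E.
  move=> v1; have v0 : (0 < v)%R by exact: lt_trans v1.
  have w01 : (0 < v^-1 < 1)%R by rewrite invr_gt0 v0 invf_lt1.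
  have w01' : (0 <= v^-1 <= 1)%R by case/andP: w01 => *; rewrite !ltW.
  apply: le_trans (bayes_moment_bound w01).
  rewrite -integral_cst//.
  apply: (@le_trans _ _ (\int[P]_(t in N)
      (bayes_factor v^-1 (p t) (q t) `^ c)%:E)).
    apply: ae_ge0_le_integral => //.
    - by move=> t _; rewrite /= lee_fin powR_ge0.
    - exact: measurable_bayes_factor_powR.
    - apply: filterS p_gt0 => t pt qt.
      rewrite lee_fin /bayes_factor qt mul0r addr0.
      by rewrite invfM invrK mulrA divff ?gt_eqF// mul1r.
  apply: ge0_subset_integral => //.
  exact: measurable_bayes_factor_powR.
have PNf : P N \is a fin_num by rewrite fin_num_measure.
have : 0 <= P N by [].
rewrite -(fineK PNf) lee_fin le_eqVlt => /predU1P[<-//|x0]; exfalso.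
set x := fine (P N) in x0 *.
(* a base [b] with [b * x > k] and [b > 1]; [v = b `^ c^-1] contradicts [PN] *)
pose b : R := (2 + `|k| / x)%R.
have kx : (0 <= `|k| / x)%R by rewrite divr_ge0// ltW.
have b1 : (1 < b)%R by rewrite /b; lra.
have v1 : (1 < b `^ c^-1)%R.
  have <- : (1 `^ c^-1 = 1 :> R)%R by rewrite powR1.
  apply: gt0_ltr_powR => //.
  - by rewrite invr_gt0.
  - by rewrite nnegrE.
  - by rewrite nnegrE ltW// (lt_trans _ b1).
have := PN _ v1.
rewrite -powRrM mulVf ?gt_eqF// powRr1 ?(ltW (lt_trans _ b1))//.
rewrite -(fineK PNf) -/x -EFinM lee_fin /b mulrDl divfK ?gt_eqF//.
by have := ler_norm k; lra.
Qed.

(** Fatou's lemma along [w = 1 / (n + 2)]: by [bayes_moment_null] almost every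
   point has [q > 0], where the factors converge. *)
Lemma bayes_moment0_le : bayes_moment 0 <= k%:E.
Proof.
have q_gt0 : {ae P, forall t, 0 < q t}%R.
  exact: ae_gt0 bayes_moment_null.
pose w n : R := (n.+2%:R^-1)%R.
have w01 n : (0 < w n < 1)%R by rewrite invr_gt0 ltr0n/= invf_lt1 ?ltr1n ?ltr0n.
have w01' n : (0 <= w n <= 1)%R by case/andP: (w01 n) => *; rewrite !ltW.
have mG n : measurable_fun setT
    (fun t => (bayes_factor (w n) (p t) (q t) `^ c)%:E).
  exact: measurable_bayes_factor_powR.
pose G n t := (bayes_factor (w n) (p t) (q t) `^ c)%:E.
apply: (@le_trans _ _ (\int[P]_t limn_einf (G^~ t))).
  apply: ae_ge0_le_integral => //.
  - by apply: measurable_bayes_factor_powR; rewrite lexx ler01.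
  - move=> t _; rewrite limn_einf_lim.
    apply: lime_ge; first exact: is_cvg_einfs.
    by apply: nearW => n; apply: le_ereal_inf_tmp => _ [m _ <-];
      exact: factor_ge0.
  - apply: measurableT_comp => //; apply: measurable_fun_limn_esup => n.
    apply: (measurableT_comp _ (mG n)); exact: oppe_measurable.
  - apply: filterS2 p_gt0 q_gt0 => t pt qt _.
    have h : G^~ t @ \oo --> (bayes_factor 0 (p t) (q t) `^ c)%:E.
      by apply: cvg_EFin; [exact: nearW|exact: cvg_bayes_factor].
    by rewrite (cvg_limn_einf_sup h).1.
apply: (le_trans (fatou P measurableT mG (fun n t _ => factor_ge0 (w n) t))).
rewrite limn_einf_lim; apply: lime_le; first exact: is_cvg_einfs.
apply: nearW => n; apply: ereal_inf_le.
exists (\int[P]_t G n t); first by exists n => /=.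
exact: bayes_moment_bound.
Qed.

End bayes_moment.

(** * Renyi divergence in terms of densities *)

Section renyi_density.
Context d (Y : measurableType d) (R : realType).
Local Open Scope ereal_scope.
Local Open Scope charge_scope.

(** Multiplying [m / m'] by the density [m'] of [P'] restores [m] except on
   [m' = 0], which [P] does not charge. *)
Lemma density_div (mu P P' : {measure set Y -> \bar R}) m m' :
  is_density mu P m -> is_density mu P' m' -> P [set t | m' t = 0%R] = 0 ->
  is_density P' P (fun t => m t / m' t)%R.
Proof.
move=> [mm m0 PE] mP'; have [mm' m'0 _] := mP'.
set N := [set t | _] => PN0.
have mN : measurable N by exact: measurable_zeros.
have mr : measurable_fun setT (fun t => m t / m' t)%R.
  exact: measurable_fun_div.
have r0 t : (0 <= m t / m' t)%R by rewrite divr_ge0.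
split => // A mA.
rewrite (integral_density mP')//; [|exact/measurable_funTS/measurable_EFinP].
have -> : P A = P (A `\` N).
  rewrite [LHS](measureDI P mA mN) [X in _ + X](_ : _ = 0) ?adde0//.
  by apply: (subset_measure0 _ _ _ PN0) => //; exact: measurableI.
rewrite PE; last exact: measurableD.
rewrite setDE integral_mkcondr; apply: eq_integral => t _.
rewrite patchE /N; case: ifPn => [/[!inE]/= /eqP n0|].
  by rewrite -EFinM divfK.
by rewrite notin_setE /= => /contrapT ->; rewrite mule0.
Qed.

Lemma density_dominates (mu P : {measure set Y -> \bar R}) m :
  is_density mu P m -> P `<< mu.
Proof.
move=> [mm m0 PE]; apply/null_content_dominatesP => A mA A0.
rewrite PE// -(@integral_abs_eq0 _ _ _ mu A (EFin \o m))//.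
  by apply: eq_integral => t _; rewrite gee0_abs// lee_fin.
exact/measurable_funTS/measurable_EFinP.
Qed.

(** The null event [m' = 0] is exactly absolute continuity, by [density_div]
   and [density_dominates]; under it [m / m'] agrees almost surely with the
   Radon-Nikodym derivative, and the logarithm is removed by monotonicity. *)
Lemma renyi_divergence_le mu (P P' : probability Y R) m m' (a e : R) :
  (1 < a)%R -> is_density mu P m -> is_density mu P' m' ->
  renyi_divergence a P P' <= e%:E <->
  P [set t | m' t = 0%R] = 0 /\
  bayes_moment P m m' (a - 1) 0 <= (expR ((a - 1) * e))%:E.
Proof.
move=> a1 mP mP'; rewrite /renyi_divergence.
have b0 : (0 < a - 1)%R by rewrite subr_gt0.
case: asboolP => [PP'|nPP']; last first.
  split=> [|[PN0 _]]; first by rewrite leye_eq.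
  by exfalso; apply/nPP'/density_dominates/(density_div mP mP' PN0).
have PN0 : P [set t | m' t = 0%R] = 0.
  move/null_content_dominatesP : PP'; apply; last exact: density_zero mP'.
  by apply: measurable_zeros; have [] := mP'.
have [mr r0 PE] := density_div mP mP' PN0.
have RNr : ae_eq P setT ('d (charge_of_finite_measure P) '/d P')
    (EFin \o (fun t => m t / m' t)%R).
  apply: (null_dominates_ae_eq measurableT PP').
  apply: integral_ae_eq => //.
  - exact: Radon_Nikodym_integrable.
  - exact/measurable_EFinP.
  - by move=> A _ mA; rewrite -Radon_Nikodym_integral// -PE.
have -> : \int[P]_y (('d (charge_of_finite_measure P) '/d P') y `^ (a - 1)) =
    bayes_moment P m m' (a - 1) 0.
  apply: ae_eq_integral => //.
  - apply: (measurableT_comp (measurable_poweR _)) => //.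
  - have [mm m0 _] := mP; have [mm' m'0 _] := mP'.
    by apply: measurable_bayes_factor_powR; rewrite ?lexx ?ler01.
  - by apply: filterS RNr => t /= /(_ I) -> _; rewrite bayes_factor0.
have I0 : 0 <= bayes_moment P m m' (a - 1) 0.
  by apply: integral_ge0 => t _; rewrite lee_fin powR_ge0.
rewrite lee_pdivrMl// -EFinM -[lne _ <= _]lee_expeR.
move: (lneK_eq (bayes_moment P m m' (a - 1) 0)); rewrite I0 => /eqP ->.
by split => [|[]].
Qed.

(** [P] has density 1 with respect to itself. *)
Lemma renyi_divergence_refl (P : probability Y R) (a : R) : (1 < a)%R ->
  renyi_divergence a P P <= 0.
Proof.
move=> a1.
have PP : is_density P P (cst 1%R).
  by split => // A mA; rewrite [RHS](integral_cst _ mA 1%E) mul1e.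
apply/(renyi_divergence_le _ a1 PP PP); split.
  by rewrite [X in P X](_ : _ = set0)// -subset0 => t /= /eqP; rewrite oner_eq0.
rewrite mulr0 expR0 /bayes_moment.
under eq_integral do rewrite bayes_factor0 divr1 powR1.
by rewrite (integral_cst _ measurableT 1%E) mul1e [X in X <= _]probability_setT.
Qed.

End renyi_density.

(** * Two-point priors on neighbours *)

Section priors.
Context d (X : measurableType d) (R : realType).
Hypothesis mX : forall x : X, measurable [set x].
Variable nb : X -> X -> Prop.
Local Open Scope ereal_scope.

Let dirac1 (y z : X) : \d_y [set z] = (y == z)%:R%:E :> \bar R.
Proof.
rewrite diracE; have [->|/eqP yz] := eqVneq y z; first by rewrite mem_set.
by rewrite memNset.
Qed.

(** The two atoms of [Q] have positive masses with sum 1, so a pair of full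
   mass contains both: the atoms are the neighbours, up to their order. *)
Lemma neighbour_prior_atom (nb_sym : forall x x', nb x x' -> nb x' x)
    (Q : probability X R) (x : X) :
  neighbour_prior nb Q -> Q [set x] != 0 ->
  exists (x' : X) (w : R), [/\ x != x', nb x x', (0 < w < 1)%R,
    Q [set x] = w%:E & Q [set x'] = (1 - w)%:E].
Proof.
move=> [[Z [v [Z2 v0 v1 QE]]] [z [z' [zz' Qzz']]]] Qx.
have [y [y' [yy' [vy vy' v1' {}QE]]]] : exists y y', y != y' /\
    [/\ (0 < v y)%R, (0 < v y')%R, (v y + v y' = 1)%R &
     forall A, measurable A -> Q A = (v y)%:E * \d_y A + (v y')%:E * \d_y' A].
  have memZ t : t \in enum_fset Z -> t \in Z by [].
  move: Z2 v1 QE (fset_uniq Z) memZ.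
  rewrite /=; case: (enum_fset Z) => [|y [|y' []]]//= _.
  rewrite big_cons big_seq1 => v1 QE; rewrite inE andbT => yy' memZ.
  exists y, y'; split => //; split => //.
  - by apply/v0/memZ; rewrite inE eqxx.
  - by apply/v0/memZ; rewrite !inE eqxx orbT.
  - by move=> A mA; rewrite QE// big_cons big_seq1.
(* the two atoms can be exchanged, so that [x] is the first one *)
wlog xy : y y' yy' vy vy' v1' QE / x = y.
  move=> wl; have [xy|xy] := eqVneq x y; first exact: (wl y y').
  apply: (wl y' y) => //; first by rewrite eq_sym.
  - by rewrite addrC.
  - by move=> A mA; rewrite addeC QE.
  - move: Qx; rewrite QE// !dirac1 [y == x]eq_sym (negbTE xy) mule0 add0e.
    by case: (eqVneq y' x) => [->//|_]; rewrite mule0 eqxx.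
subst y.
have atomE u : Q [set u] = (v x * (x == u)%:R + v y' * (y' == u)%:R)%:E.
  by rewrite QE// !dirac1.
have mzz' : measurable [set z; z'] by exact: measurableU.
have [xz yz] : (x = z \/ x = z') /\ (y' = z \/ y' = z').
  have : (v x * (x \in [set z; z'])%:R + v y' * (y' \in [set z; z'])%:R = 1)%R.
    by apply: EFin_inj; rewrite -Qzz' QE// !diracE.
  have vx1 : (v x < 1)%R by rewrite -v1' ltrDl.
  have vy1 : (v y' < 1)%R by rewrite -v1' ltrDr.
  case: (boolP (x \in _)) => [/set_mem xin|_];
    case: (boolP (y' \in _)) => [/set_mem yin|_] //;
    rewrite ?mulr0 ?mulr1 ?addr0 ?add0r => /eqP;
    last by rewrite eq_sym oner_eq0.
  - by rewrite (lt_eqF vx1).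
  - by rewrite (lt_eqF vy1).
have nxy : nb x y'.
  move: xz yz yy' => [->|->] [->|->] //; rewrite ?eqxx// => _.
  exact: nb_sym.
exists y', (v x); split => //.
- by rewrite vy/=; lra.
- by rewrite atomE eqxx eq_sym (negbTE yy') mulr1 mulr0 addr0.
- by rewrite atomE eqxx (negbTE yy') mulr1 mulr0 add0r -v1' addrC addKr.
Qed.

(** A value of [mixture_kernel], taken as a kernel from [X] to itself with
   constant weight, is the required mixture of Dirac masses. *)
Lemma neighbour_prior_exists (x x' : X) (w : R) :
  x != x' -> nb x x' -> (0 < w < 1)%R ->
  exists Q : probability X R, [/\ neighbour_prior nb Q,
    Q [set x] = w%:E & Q [set x'] = (1 - w)%:E].
Proof.
move=> xx' nxx' /andP[w0 w1].
have W0 (_ : X) : (0 <= w)%R by exact: ltW.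
have W1 (_ : X) : (0 <= 1 - w)%R by rewrite subr_ge0 ltW.
have mW : measurable_fun setT (fun _ : X => w) by [].
pose Q := law (mixture_kernel x x' W0 W1 mW) x.
have QE A : Q A = w%:E * \d_x A + (1 - w)%:E * \d_x' A by exact: mixtureE.
have x'x : x' != x by rewrite eq_sym.
exists Q; split.
- split; last first.
    exists x, x'; split => //.
    rewrite QE !diracE !mem_set/=; [|by right|by left].
    by rewrite !mule1 -EFinD addrC subrK.
  exists [fset x; x']%fset, (fun z => if z == x then w else 1 - w)%R.
  have xin : x \notin [fset x']%fset by rewrite inE.
  split.
  + by rewrite cardfs2 xx'.
  + by move=> z _; case: ifP => // _; rewrite subr_gt0.
  + by rewrite big_fsetU1//= big_seq_fset1 eqxx (negbTE x'x) addrC subrK.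
  + by move=> A mA; rewrite big_fsetU1//= big_seq_fset1 eqxx (negbTE x'x) QE.
- by rewrite QE !dirac1 eqxx (negbTE x'x) mule0 adde0 mule1.
- by rewrite QE !dirac1 eqxx (negbTE xx') mule0 add0e mule1.
Qed.

End priors.

(** * Exponentiated gain of the posterior *)

Section posterior_gain.
Context d d' (X : measurableType d) (Y : measurableType d') (R : realType).
Hypothesis mX : forall x : X, measurable [set x].
Local Open Scope ereal_scope.

(** The identity holds at every outcome, including those where the posterior
   mass of [x] is 0: the gain is then [-oo] and both sides are 0. It yields
   measurability of the integrand in [posterior_gain_integral]. *)
Lemma exp_gain_log_score (a w : R) (Q QT : probability X R) (x : X) :
  (1 < a)%R -> (0 < w)%R -> Q [set x] = w%:E ->
  exp_gain a (score_gain log_score Q QT x) =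
    ((fine (QT [set x]) / w) `^ (a - 1))%:E.
Proof.
move=> a1 w0 Qx; rewrite /score_gain /log_score Qx lne_EFin//.
have a0 : (0 < a - 1)%R by rewrite subr_gt0.
have : 0 <= QT [set x] by exact: measure_ge0.
have QTf : QT [set x] \is a fin_num by exact: fin_num_measure (mX x).
rewrite -{1 2}(fineK QTf); set k := fine _; rewrite lee_fin le_eqVlt.
move=> /predU1P[<-|k0].
  by rewrite /= lexx/= /exp_gain mul0r powR0 ?gt_eqF// gt0_muleNy ?lte_fin.
rewrite lne_EFin//= /exp_gain -EFinB -EFinM /= /powR gt_eqF ?divr_gt0//.
by rewrite ln_div ?posrE// opprK [(- _ + _)%R]addrC.
Qed.

(** The densities [m], [m'] on the right need not be those through which the
   posterior [K] is defined, by [density_proportional]; this allows comparing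
   posteriors of priors with different weights. *)
Lemma posterior_gain_integral (M : R.-pker X ~> Y) (Q : probability X R)
    (K : R.-pker Y ~> X) (mu : {measure set Y -> \bar R}) m m' (a w : R) x x' :
  (1 < a)%R -> (0 < w < 1)%R -> x != x' ->
  Q [set x] = w%:E -> Q [set x'] = (1 - w)%:E -> is_posterior M Q K ->
  is_density mu (law M x) m -> is_density mu (law M x') m' ->
  \int[law M x]_t exp_gain a (score_gain log_score Q (law K t) x) =
  bayes_moment (law M x) m m' (a - 1) w.
Proof.
move=> a1 /andP[w0 w1] xx' Qx Qx' [_ [nu [n [nP Kn]]]] mP mP'.
have [mm m0 _] := mP; have [mm' m'0 _] := mP'.
have w'0 : (0 < 1 - w)%R by rewrite subr_gt0.
have Qx0 : Q [set x] != 0 by rewrite Qx eqe gt_eqF.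
have Qx'0 : Q [set x'] != 0 by rewrite Qx' eqe gt_eqF.
have nx : is_density nu (law M x) (n x) := nP _ Qx0.
have nx' : is_density nu (law M x') (n x') := nP _ Qx'0.
have [_ _ _] := nx; have [_ n'0 _] := nx'.
under eq_integral do rewrite (exp_gain_log_score _ _ w0)//.
apply: ae_eq_integral => //.
- apply/measurable_EFinP; apply: (measurableT_comp (measurable_powR _)).
  apply: measurable_funM => //.
  apply: measurableT_comp => //.
  exact: measurable_kernel.
- by apply: measurable_bayes_factor_powR => //; rewrite !ltW.
- have := density_proportional mP mP' nx nx'.
  apply: filterS3 (density_ae_gt0 mP) (density_ae_gt0 nx) => t mt nt mn _.
  congr (_ `^ _)%:E.
  have nD : (0 < n x t * w + n x' t * (1 - w))%R.
    by rewrite ltr_pwDl ?mulr_gt0// mulr_ge0// ltW.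
  have mD : (0 < m t * w + m' t * (1 - w))%R.
    by rewrite ltr_pwDl ?mulr_gt0// mulr_ge0// ltW.
  have := Kn x x' xx' Qx0 Qx'0 t; rewrite Qx /= gt_eqF// => /(_ isT).
  rewrite -[K t _]/(law K t _) => -> /=.
  rewrite mulrAC mulfK ?gt_eqF// /bayes_factor.
  apply/eqP; rewrite eqr_div ?lt0r_neq0//; apply/eqP.
  by rewrite !mulrDr !mulrA [(n x t * m t)%R]mulrC mn.
Qed.

End posterior_gain.

(** * The equivalence *)

Theorem proposition12 (d d' : measure_display) (X : measurableType d)
    (Y : measurableType d') (R : realType)
    (mX : forall x : X, measurable [set x])
    (nb : X -> X -> Prop) (nb_sym : forall x x', nb x x' -> nb x' x)
    (M : R.-pker X ~> Y)
    (post : probability X R -> R.-pker Y ~> X)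
    (post_bayes : forall Q, neighbour_prior nb Q -> is_posterior M Q (post Q))
    (alpha eps : R) (alpha1 : 1 < alpha) (eps0 : 0 <= eps) :
  RDP nb M alpha eps <->
  PPE M post log_score (neighbour_prior nb) (exp_gain alpha)
    (expR ((alpha - 1) * eps)).
Proof.
have a0 : 0 < alpha - 1 by rewrite subr_gt0.
have k1 : 1 <= expR ((alpha - 1) * eps).
  by rewrite -[leLHS]expR0 ler_expR mulr_ge0// ltW.
rewrite /RDP /PPE; split => [/ereal_supP rdp|/ereal_supP ppe].
- apply/ereal_supP => _ [x _ <-]; apply/ereal_supP => _ [Q nQ <-].
  have postQ := post_bayes Q nQ.
  have [Qx|Qx] := eqVneq (Q [set x]) 0%E.
    under eq_integral => t _.
      rewrite /score_gain /log_score Qx.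
      rewrite (postQ.1 _ Qx t : law (post Q) t [set x] = 0%E).
      rewrite /= lexx /= /exp_gain mule0 expeR0.
      over.
    rewrite (integral_cst _ measurableT 1%E) mul1e.
    by rewrite [X in (X <= _)%E]probability_setT lee_fin.
  have [x' [w [xx' nxx' w01 Qxw Qx'w]]] := neighbour_prior_atom mX nb_sym nQ Qx.
  have [_ [mu [m [dm _]]]] := postQ.
  have mP : is_density mu (law M x) (m x) by exact: dm.
  have mP' : is_density mu (law M x') (m x').
    by apply: dm; rewrite Qx'w eqe gt_eqF// subr_gt0; case/andP: w01.
  rewrite (posterior_gain_integral mX alpha1 w01 xx' Qxw Qx'w postQ mP mP').
  have : (renyi_divergence alpha (law M x) (law M x') <= eps%:E)%E.
    by apply: rdp; exists (x', x) => //=; exact: nb_sym.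
  move=> /(renyi_divergence_le _ alpha1 mP mP')[N0 l0].
  have [mm m0 _] := mP; have [mm' m'0 _] := mP'.
  apply: bayes_moment_le => //.
  + exact: density_ae_gt0 mP.
  + exact: ae_gt0.
  + by case/andP: w01 => *; rewrite !ltW.
- apply/ereal_supP => _ [[x' x] /= nxx' <-].
  have {}nxx' := nb_sym _ _ nxx'.
  have [<-|xx'] := eqVneq x x'.
    by apply: le_trans (renyi_divergence_refl _ alpha1) _; rewrite lee_fin.
  have Qex (w : R) (w01 : 0 < w < 1) := neighbour_prior_exists xx' nxx' w01.
  (* any prior provides densities common to [M x] and [M x'] *)
  have h01 : 0 < (2^-1 : R) < 1.
    by rewrite invr_gt0 ltr0n/= invf_lt1 ?ltr1n ?ltr0n.
  have [Q [nQ Qx Qx']] := Qex _ h01.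
  have [_ [mu [m [dm _]]]] := post_bayes _ nQ.
  have mP : is_density mu (law M x) (m x).
    by apply: dm; rewrite Qx eqe gt_eqF//; case/andP: h01.
  have mP' : is_density mu (law M x') (m x').
    by apply: dm; rewrite Qx' eqe gt_eqF// subr_gt0; case/andP: h01.
  have [mm m0 _] := mP; have [mm' m'0 _] := mP'.
  have bound (w : R) : 0 < w < 1 ->
      (bayes_moment (law M x) (m x) (m x') (alpha - 1) w <=
        (expR ((alpha - 1) * eps))%:E)%E.
    move=> w01; have [Qw [nQw Qwx Qwx']] := Qex _ w01.
    rewrite -(posterior_gain_integral mX alpha1 w01 xx' Qwx Qwx'
      (post_bayes _ nQw) mP mP').
    apply: le_trans (ppe _ _); last by exists x.
    by apply: ereal_sup_ubound; exists Qw.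
  apply/(renyi_divergence_le _ alpha1 mP mP'); split.
  + by apply: bayes_moment_null bound => //; exact: density_ae_gt0 mP.
  + by apply: bayes_moment0_le bound => //; exact: density_ae_gt0 mP.
Qed.
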